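(* There is a bijective correspondence between strict $Leib_\infty$-conformal algebras and crossed modules of Leibniz conformal algebras.
   Context: Tensor products are over $\mathbb{C}$; $\partial$ acts coefficientwise on formal power series, and maps are extended coefficientwise to power series arguments. For $\mathbb{C}[\partial]$-modules, a $\mathbb{C}$-linear map $\varphi:M_1\otimes M_2\to N[[\lambda]]$ is conformal sesquilinear if $\varphi_\lambda(\partial x,y)=-\lambda\varphi_\lambda(x,y)$ and $\varphi_\lambda(x,\partial y)=(\partial+\lambda)\varphi_\lambda(x,y)$; a $\mathbb{C}$-linear map $\varphi:M_1\otimes M_2\otimes M_3\to N[[\lambda,\mu]]$ is conformal sesquilinear if $\varphi_{\lambda,\mu}(\partial x,y,z)=-\lambda\varphi_{\lambda,\mu}(x,y,z)$, $\varphi_{\lambda,\mu}(x,\partial y,z)=-\mu\varphi_{\lambda,\mu}(x,y,z)$, $\varphi_{\lambda,\mu}(x,y,\partial z)=(\partial+\lambda+\mu)\varphi_{\lambda,\mu}(x,y,z)$. A Leibniz conformal algebra is a $\mathbb{C}[\partial]$-module $\mathfrak{g}$ with a conformal sesquilinear $\lambda$-bracket $[\cdot_\lambda\cdot]:\mathfrak{g}\otimes\mathfrak{g}\to\mathfrak{g}[[\lambda]]$ (also written $[\cdot_\lambda\cdot]^{\mathfrak{g}}$) satisfying $[x_\lambda[y_\mu z]]=[[x_\lambda y]_{\lambda+\mu}z]+[y_\mu[x_\lambda z]]$. A morphism is a $\mathbb{C}[\partial]$-linear map preserving the $\lambda$-brackets. A representation of $\mathfrak{g}$ is a $\mathbb{C}[\partial]$-module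 $M$ with conformal sesquilinear left and right $\lambda$-actions $\mathfrak{g}\otimes M\to M[[\lambda]]$, $x\otimes v\mapsto x_\lambda v$ and $M\otimes\mathfrak{g}\to M[[\lambda]]$, $v\otimes x\mapsto v_\lambda x$ such that $x_\lambda(y_\mu v)=[x_\lambda y]_{\lambda+\mu}v+y_\mu(x_\lambda v)$, $x_\lambda(v_\mu y)=(x_\lambda v)_{\lambda+\mu}y+v_\mu[x_\lambda y]$, $v_\lambda[x_\mu y]=(v_\lambda x)_{\lambda+\mu}y+x_\mu(v_\lambda y)$. A strict $Leib_\infty$-conformal algebra is a $2$-term $Leib_\infty$-conformal algebra with $\rho_3=0$. A $2$-term $Leib_\infty$-conformal algebra $(\mathcal{G}_1\xrightarrow{d}\mathcal{G}_0,\rho_2,\rho_3)$ consists of a complex of $\mathbb{C}[\partial]$-modules $\mathcal{G}_1\xrightarrow{d}\mathcal{G}_0$, conformal sesquilinear maps $\rho_2:\mathcal{G}_i\otimes\mathcal{G}_j\to\mathcal{G}_{i+j}[[\lambda]]$ for $0\le i,j,i+j\le1$, and a conformal sesquilinear map $\rho_3:\mathcal{G}_0^{\otimes3}\to\mathcal{G}_1[[\lambda,\mu]]$ such that for all $x,y,z,w\in\mathcal{G}_0$, $u,v\in\mathcal{G}_1$: (i) $(\rho_2)_\lambda(u,v)=0$ (i.e. $\rho_2$ is zero on $\mathcal{G}_1\otimes\mathcal{G}_1$); (ii) $d((\rho_2)_\lambda(x,u))=(\rho_2)_\lambda(x,du)$; (iii) $d((\rho_2)_\lambda(u,x))=(\rho_2)_\lambda(du,x)$;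 (iv) $(\rho_2)_\lambda(du,v)=(\rho_2)_\lambda(u,dv)$; (v) $d((\rho_3)_{\lambda,\mu}(x,y,z))=(\rho_2)_\lambda(x,(\rho_2)_\mu(y,z))-(\rho_2)_{\lambda+\mu}((\rho_2)_\lambda(x,y),z)-(\rho_2)_\mu(y,(\rho_2)_\lambda(x,z))$; (vi) $(\rho_3)_{\lambda,\mu}(x,y,dv)=(\rho_2)_\lambda(x,(\rho_2)_\mu(y,v))-(\rho_2)_{\lambda+\mu}((\rho_2)_\lambda(x,y),v)-(\rho_2)_\mu(y,(\rho_2)_\lambda(x,v))$; (vii) $(\rho_3)_{\lambda,\mu}(x,dv,y)=(\rho_2)_\lambda(x,(\rho_2)_\mu(v,y))-(\rho_2)_{\lambda+\mu}((\rho_2)_\lambda(x,v),y)-(\rho_2)_\mu(v,(\rho_2)_\lambda(x,y))$; (viii) $(\rho_3)_{\lambda,\mu}(dv,x,y)=(\rho_2)_\lambda(v,(\rho_2)_\mu(x,y))-(\rho_2)_{\lambda+\mu}((\rho_2)_\lambda(v,x),y)-(\rho_2)_\mu(x,(\rho_2)_\lambda(v,y))$; (ix) $(\rho_2)_\lambda(x,(\rho_3)_{\mu,\nu}(y,z,w))-(\rho_2)_\mu(y,(\rho_3)_{\lambda,\nu}(x,z,w))+(\rho_2)_\nu(z,(\rho_3)_{\lambda,\mu}(x,y,w))+(\rho_2)_{\lambda+\mu+\nu}((\rho_3)_{\lambda,\mu}(x,y,z),w)-(\rho_3)_{\lambda+\mu,\nu}((\rho_2)_\lambda(x,y),z,w)-(\rho_3)_{\mu,\lambda+\nu}(y,(\rho_2)_\lambda(x,z),w)-(\rho_3)_{\mu,\nu}(y,z,(\rho_2)_\lambda(x,w))+(\rho_3)_{\lambda,\mu+\nu}(x,(\rho_2)_\mu(y,z),w)+(\rho_3)_{\lambda,\nu}(x,z,(\rho_2)_\mu(y,w))-(\rho_3)_{\lambda,\mu}(x,y,(\rho_2)_\nu(z,w))=0$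 (automatic when $\rho_3=0$). A crossed module of Leibniz conformal algebras is a quintuple $(\mathfrak{g},\mathfrak{h},d,\Phi^l,\Phi^r)$ where $\mathfrak{g},\mathfrak{h}$ are Leibniz conformal algebras, $d:\mathfrak{g}\to\mathfrak{h}$ is a morphism of Leibniz conformal algebras, and $\Phi^l:\mathfrak{h}\otimes\mathfrak{g}\to\mathfrak{g}[[\lambda]]$, $\Phi^r:\mathfrak{g}\otimes\mathfrak{h}\to\mathfrak{g}[[\lambda]]$ are conformal sesquilinear maps making the $\mathbb{C}[\partial]$-module $\mathfrak{g}$ a representation of $\mathfrak{h}$ (left action $\Phi^l$, right action $\Phi^r$) such that for $x,y\in\mathfrak{g}$, $h\in\mathfrak{h}$: $d(\Phi^l_\lambda(h,x))=[h_\lambda(dx)]^{\mathfrak{h}}$; $d(\Phi^r_\lambda(x,h))=[(dx)_\lambda h]^{\mathfrak{h}}$; $\Phi^l_\lambda(dx,y)=[x_\lambda y]^{\mathfrak{g}}=\Phi^r_\lambda(x,dy)$; $[x_\lambda\Phi^r_\mu(y,h)]^{\mathfrak{g}}=\Phi^r_{\lambda+\mu}([x_\lambda y]^{\mathfrak{g}},h)+[y_\mu\Phi^r_\lambda(x,h)]^{\mathfrak{g}}$; $[x_\lambda\Phi^l_\mu(h,y)]^{\mathfrak{g}}=[\Phi^r_\lambda(x,h)_{\lambda+\mu}y]^{\mathfrak{g}}+\Phi^l_\mu(h,[x_\lambda y]^{\mathfrak{g}})$; $\Phi^l_\lambda(h,[x_\mu y]^{\mathfrak{g}})=[\Phi^l_\lambda(h,x)_{\lambda+\mu}y]^{\mathfrak{g}}+[x_\mu\Phi^l_\lambda(h,y)]^{\mathfrak{g}}$.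 *)

(* Defs.v *)
From HB Require Import structures.
From mathcomp Require Import all_boot all_order all_algebra.
From mathcomp Require Import all_classical all_reals.
From mathcomp Require Import complex.

Set Implicit Arguments.
Unset Strict Implicit.
Unset Printing Implicit Defensive.

Import GRing.Theory.
Local Open Scope ring_scope.

(* A C[d]-module is an lmodType over {poly K} with K = C; d acts as 'X, and
   C acts through the constant polynomials.  C-linear maps out of tensor
   products over C are represented by C-multilinear maps. *)

Definition del (K : fieldType) (M : lmodType {poly K}) (x : M) : M := 'X *: x.

Definition Klinear (K : fieldType) (M N : lmodType {poly K}) (f : M -> N) :
    Prop :=
  forall (c : K) (x y : M), f (c%:P *: x + y) = c%:P *: f x + f y.

(* M[[l]] is nat -> M and M[[l, m]] is nat -> nat -> M, where s a b is the
   coefficient of l^a m^b (and likewise with three variables).  The library's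
   pointwise module structure on functions makes these C[d]-modules, with d
   acting coefficientwise. *)

(* Multiplication by the outermost variable. *)
Definition mulvar (V : zmodType) (s : nat -> V) : nat -> V :=
  fun n => if n is m.+1 then s m else 0.

(* s(t) |-> s(l + m) *)
Definition subst_add (V : zmodType) (s : nat -> V) : nat -> nat -> V :=
  fun a b => s (a + b)%N *+ 'C(a + b, a).

(* s(t) |-> s(l + m + n) *)
Definition subst_add3 (V : zmodType) (s : nat -> V) : nat -> nat -> nat -> V :=
  fun a => subst_add (subst_add s a).

Record sesquilinear2 (K : fieldType) (M1 M2 N : lmodType {poly K})
    (phi : M1 -> M2 -> nat -> N) : Prop := Sesquilinear2 {
  sesq2_linl : forall y, Klinear (fun x => phi x y);
  sesq2_linr : forall x, Klinear (phi x);
  sesq2_dell : forall x y, phi (del x) y = - mulvar (phi x y);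
  sesq2_delr : forall x y, phi x (del y) = del (phi x y) + mulvar (phi x y)
}.

(* mulvar (phi x y z) multiplies by l, and fun a => mulvar (phi x y z a)
   multiplies by m. *)
Record sesquilinear3 (K : fieldType) (M1 M2 M3 N : lmodType {poly K})
    (phi : M1 -> M2 -> M3 -> nat -> nat -> N) : Prop := Sesquilinear3 {
  sesq3_lin1 : forall y z, Klinear (fun x => phi x y z);
  sesq3_lin2 : forall x z, Klinear (fun y => phi x y z);
  sesq3_lin3 : forall x y, Klinear (phi x y);
  sesq3_del1 : forall x y z, phi (del x) y z = - mulvar (phi x y z);
  sesq3_del2 : forall x y z,
    phi x (del y) z = - (fun a => mulvar (phi x y z a));
  sesq3_del3 : forall x y z,
    phi x y (del z) = del (phi x y z) + mulvar (phi x y z)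
                      + (fun a => mulvar (phi x y z a))
}.

(* f_l(s_m) *)
Definition nest_lm (P N : Type) (f : P -> nat -> N) (s : nat -> P) :
    nat -> nat -> N :=
  fun a b => f (s b) a.

(* f_m(s_l) *)
Definition nest_ml (P N : Type) (f : P -> nat -> N) (s : nat -> P) :
    nat -> nat -> N :=
  fun a b => f (s a) b.

(* f_{l + m}(s_l), that is, the sum over i of l^i f_{l + m}(s_i) *)
Definition nest_sum (P : Type) (N : zmodType) (f : P -> nat -> N)
    (s : nat -> P) : nat -> nat -> N :=
  fun a b => \sum_(i < a.+1) subst_add (f (s i)) (a - i)%N b.

Record leibniz_on (K : fieldType) (g : lmodType {poly K}) := LeibnizOn {
  lbr :> g -> g -> nat -> g;
  lbr_sesq : sesquilinear2 lbr;
  lbr_leibniz : forall x y z,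
    nest_lm (lbr x) (lbr y z)
    = nest_sum (fun w => lbr w z) (lbr x y) + nest_ml (lbr y) (lbr x z)
}.

Definition leibniz_morphism (K : fieldType) (g h : lmodType {poly K})
    (bg : leibniz_on g) (bh : leibniz_on h) (f : {linear g -> h}) : Prop :=
  forall x y, (fun n => f (bg x y n)) = bh (f x) (f y).

Record representation (K : fieldType) (h M : lmodType {poly K})
    (b : leibniz_on h) (l : h -> M -> nat -> M) (r : M -> h -> nat -> M) :
    Prop := Representation {
  rep_sesql : sesquilinear2 l;
  rep_sesqr : sesquilinear2 r;
  rep_ll : forall x y v,
    nest_lm (l x) (l y v)
    = nest_sum (fun w => l w v) (b x y) + nest_ml (l y) (l x v);
  rep_lr : forall x v y,
    nest_lm (l x) (r v y)
    = nest_sum (fun w => r w y) (l x v) + nest_ml (r v) (b x y);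
  rep_rr : forall v x y,
    nest_lm (r v) (b x y)
    = nest_sum (fun w => r w y) (r v x) + nest_ml (l x) (r v y)
}.

(* rho_2 is given by its components rho_ij : G_i (x) G_j -> G_(i+j)[[l]] with
   i + j <= 1; it vanishes on G_1 (x) G_1, so there is no fourth component. *)
Record two_term (K : fieldType) (G1 G0 : lmodType {poly K}) := TwoTerm {
  tt_d : {linear G1 -> G0};
  rho00 : G0 -> G0 -> nat -> G0;
  rho01 : G0 -> G1 -> nat -> G1;
  rho10 : G1 -> G0 -> nat -> G1;
  rho3 : G0 -> G0 -> G0 -> nat -> nat -> G1;
  rho00_sesq : sesquilinear2 rho00;
  rho01_sesq : sesquilinear2 rho01;
  rho10_sesq : sesquilinear2 rho10;
  rho3_sesq : sesquilinear3 rho3;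
  tt_d01 : forall x u, (fun n => tt_d (rho01 x u n)) = rho00 x (tt_d u);
  tt_d10 : forall u x, (fun n => tt_d (rho10 u x n)) = rho00 (tt_d u) x;
  tt_peiffer : forall u v, rho01 (tt_d u) v = rho10 u (tt_d v);
  tt_leib000 : forall x y z,
    (fun a b => tt_d (rho3 x y z a b))
    = nest_lm (rho00 x) (rho00 y z)
      - nest_sum (fun w => rho00 w z) (rho00 x y)
      - nest_ml (rho00 y) (rho00 x z);
  tt_leib001 : forall x y v,
    rho3 x y (tt_d v)
    = nest_lm (rho01 x) (rho01 y v)
      - nest_sum (fun w => rho01 w v) (rho00 x y)
      - nest_ml (rho01 y) (rho01 x v);
  tt_leib010 : forall x v y,
    rho3 x (tt_d v) y
    = nest_lm (rho01 x) (rho10 v y)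
      - nest_sum (fun w => rho10 w y) (rho01 x v)
      - nest_ml (rho10 v) (rho00 x y);
  tt_leib100 : forall v x y,
    rho3 (tt_d v) x y
    = nest_lm (rho10 v) (rho00 x y)
      - nest_sum (fun w => rho10 w y) (rho10 v x)
      - nest_ml (rho01 x) (rho10 v y);
  (* coefficient of l^a m^b n^c *)
  tt_coherence : forall (x y z w : G0) (a b c : nat),
      rho01 x (rho3 y z w b c) a
    - rho01 y (rho3 x z w a c) b
    + rho01 z (rho3 x y w a b) c
    + \sum_(i < a.+1) \sum_(j < b.+1)
        subst_add3 (rho10 (rho3 x y z i j) w) (a - i)%N (b - j)%N c
    - \sum_(i < a.+1)
        subst_add (fun k => rho3 (rho00 x y i) z w k c) (a - i)%N b
    - \sum_(i < a.+1) subst_add (rho3 y (rho00 x z i) w b) (a - i)%N c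
    - rho3 y z (rho00 x w a) b c
    + \sum_(j < b.+1) subst_add (rho3 x (rho00 y z j) w a) (b - j)%N c
    + rho3 x z (rho00 y w b) a c
    - rho3 x y (rho00 z w c) a b
    = 0
}.

Record strict_leib_infty (K : fieldType) := StrictLeibInfty {
  sl_G1 : lmodType {poly K};
  sl_G0 : lmodType {poly K};
  sl_tt :> two_term sl_G1 sl_G0;
  sl_strict : forall x y z, rho3 sl_tt x y z = 0
}.

Record crossed_on (K : fieldType) (g h : lmodType {poly K}) := CrossedOn {
  cm_g : leibniz_on g;
  cm_h : leibniz_on h;
  cm_d : {linear g -> h};
  cm_l : h -> g -> nat -> g;
  cm_r : g -> h -> nat -> g;
  cm_d_morphism : leibniz_morphism cm_g cm_h cm_d;
  cm_rep : representation cm_h cm_l cm_r;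
  cm_dl : forall h0 x, (fun n => cm_d (cm_l h0 x n)) = cm_h h0 (cm_d x);
  cm_dr : forall x h0, (fun n => cm_d (cm_r x h0 n)) = cm_h (cm_d x) h0;
  cm_peifferl : forall x y, cm_l (cm_d x) y = cm_g x y;
  cm_peifferr : forall x y, cm_g x y = cm_r x (cm_d y);
  cm_ggr : forall x y h0,
    nest_lm (cm_g x) (cm_r y h0)
    = nest_sum (fun w => cm_r w h0) (cm_g x y)
      + nest_ml (cm_g y) (cm_r x h0);
  cm_grg : forall x h0 y,
    nest_lm (cm_g x) (cm_l h0 y)
    = nest_sum (fun w => cm_g w y) (cm_r x h0)
      + nest_ml (cm_l h0) (cm_g x y);
  cm_lgg : forall h0 x y,
    nest_lm (cm_l h0) (cm_g x y)
    = nest_sum (fun w => cm_g w y) (cm_l h0 x)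
      + nest_ml (cm_g x) (cm_l h0 y)
}.

Record crossed_module (K : fieldType) := CrossedModule {
  xm_g : lmodType {poly K};
  xm_h : lmodType {poly K};
  xm_on :> crossed_on xm_g xm_h
}.

(* Main.v *)
(* The bracket on g = G_1 is [u, v] := rho_01(du, v) = rho_10(u, dv), so in a
   crossed module it is determined by the Peiffer identities.  The Jacobi
   identity on g and the three compatibilities between bracket and actions are
   the strict Leibniz identities with some arguments of the form du, the
   equivariance of d letting d be moved in and out of the inner bracket.
   Conversely, a crossed module gives a two-term algebra with rho_3 = 0; both
   round trips are identities by proof irrelevance. *)

Require Import Defs.
From HB Require Import structures.
From mathcomp Require Import all_boot all_order all_algebra.
From mathcomp Require Import all_classical all_reals.
From mathcomp Require Import complex.

Set Implicit Arguments.
Unset Strict Implicit.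
Unset Printing Implicit Defensive.

Import GRing.Theory.

Local Open Scope ring_scope.
Local Open Scope complex_scope.

Lemma Klinear0 (K : fieldType) (M N : lmodType {poly K}) (f : M -> N) :
  Klinear f -> f 0 = 0.
Proof.
move=> fl; have := fl 1 0 0.
by rewrite !scale1r addr0 => /eqP; rewrite -subr_eq0 opprD addrA subrr sub0r
  oppr_eq0 => /eqP.
Qed.

Lemma sesquilinear2_0l (K : fieldType) (M1 M2 N : lmodType {poly K})
    (phi : M1 -> M2 -> nat -> N) :
  sesquilinear2 phi -> forall y, phi 0 y = 0.
Proof. by move=> phiS y; apply: Klinear0 (sesq2_linl phiS y). Qed.

Lemma sesquilinear2_0r (K : fieldType) (M1 M2 N : lmodType {poly K})
    (phi : M1 -> M2 -> nat -> N) :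
  sesquilinear2 phi -> forall x, phi x 0 = 0.
Proof. by move=> phiS x; apply: Klinear0 (sesq2_linr phiS x). Qed.

(** Makes the bracket [rho01 T (tt_d T u) v] on G_1 sesquilinear: a [{poly K}]-linear map commutes
    with [del], so both conditions on the left argument survive. *)
Lemma sesquilinear2_compl (K : fieldType) (M0 M1 M2 N : lmodType {poly K})
    (phi : M1 -> M2 -> nat -> N) (f : {linear M0 -> M1}) :
  sesquilinear2 phi -> sesquilinear2 (fun x => phi (f x)).
Proof.
case=> linl linr dell delr; split=> //.
- by move=> y c u v; rewrite linearP linl.
- by move=> x y; rewrite /del linearZ dell.
Qed.

Lemma sesquilinear3_0 (K : fieldType) (M1 M2 M3 N : lmodType {poly K}) :
  sesquilinear3 (fun (_ : M1) (_ : M2) (_ : M3) => (0 : nat -> nat -> N)).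
Proof.
have mv0 (V : zmodType) : mulvar (0 : nat -> V) = 0.
  by apply/funext => -[].
have mv0' : (fun a => mulvar ((0 : nat -> nat -> N) a)) = 0.
  by apply/funext => a; apply: mv0.
split.
- by move=> y z c u v; rewrite scaler0 addr0.
- by move=> x z c u v; rewrite scaler0 addr0.
- by move=> x y c u v; rewrite scaler0 addr0.
- by move=> x y z; rewrite mv0 oppr0.
- by move=> x y z; rewrite mv0' oppr0.
- by move=> x y z; rewrite mv0 mv0' /del scaler0 !addr0.
Qed.

Lemma subst_add_0 (V : zmodType) : subst_add (0 : nat -> V) = 0.
Proof. by apply/funext => a; apply/funext => b; rewrite /subst_add mul0rn. Qed.

Lemma subst_add3_0 (V : zmodType) : subst_add3 (0 : nat -> V) = 0.
Proof.
apply/funext => a; rewrite /subst_add3 subst_add_0.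
exact: subst_add_0.
Qed.

(** Passes between the defect form of the two-term identities, when [rho3] vanishes, and the Leibniz
    form used in crossed modules. *)
Lemma sub2_eq0 (V : zmodType) (a b c : V) : 0 = a - b - c <-> a = b + c.
Proof.
rewrite -addrA -opprD; split=> [/esym/eqP|->]; last by rewrite subrr.
by rewrite subr_eq0 => /eqP.
Qed.

Section StrictToCrossed.
Variables (K : fieldType) (G1 G0 : lmodType {poly K}) (T : two_term G1 G0).
Hypothesis T_strict : forall x y z, rho3 T x y z = 0.

Lemma strict_leib000 x y z :
  nest_lm (rho00 T x) (rho00 T y z)
  = nest_sum (fun w => rho00 T w z) (rho00 T x y)
    + nest_ml (rho00 T y) (rho00 T x z).
Proof.
apply/sub2_eq0; rewrite -tt_leib000 T_strict.
by apply/funext => a; apply/funext => b; rewrite linear0.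
Qed.

Lemma strict_leib001 x y v :
  nest_lm (rho01 T x) (rho01 T y v)
  = nest_sum (fun w => rho01 T w v) (rho00 T x y)
    + nest_ml (rho01 T y) (rho01 T x v).
Proof. by apply/sub2_eq0; rewrite -tt_leib001 T_strict. Qed.

Lemma strict_leib010 x v y :
  nest_lm (rho01 T x) (rho10 T v y)
  = nest_sum (fun w => rho10 T w y) (rho01 T x v)
    + nest_ml (rho10 T v) (rho00 T x y).
Proof. by apply/sub2_eq0; rewrite -tt_leib010 T_strict. Qed.

Lemma strict_leib100 v x y :
  nest_lm (rho10 T v) (rho00 T x y)
  = nest_sum (fun w => rho10 T w y) (rho10 T v x)
    + nest_ml (rho01 T x) (rho10 T v y).
Proof. by apply/sub2_eq0; rewrite -tt_leib100 T_strict. Qed.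

Definition strict_leibniz0 : leibniz_on G0 :=
  LeibnizOn (rho00_sesq T) strict_leib000.

(** This is [strict_leib001] at [tt_d T x] and [tt_d T y]: by [tt_d01], the inner bracket of the two
    images is [tt_d T] of the bracket on G_1. *)
Lemma strict_leibniz_law1 x y z :
  nest_lm (rho01 T (tt_d T x)) (rho01 T (tt_d T y) z)
  = nest_sum (fun w => rho01 T (tt_d T w) z) (rho01 T (tt_d T x) y)
    + nest_ml (rho01 T (tt_d T y)) (rho01 T (tt_d T x) z).
Proof. by rewrite strict_leib001 -tt_d01. Qed.

Definition strict_leibniz1 : leibniz_on G1 :=
  @LeibnizOn K G1 (fun u v => rho01 T (tt_d T u) v)
    (sesquilinear2_compl (tt_d T) (rho01_sesq T)) strict_leibniz_law1.

(** Left transparent, like the converse construction, because the round trips compare data fields by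
    computation. *)
Definition crossed_of_strict : crossed_on G1 G0.
Proof.
apply: (@CrossedOn K G1 G0 strict_leibniz1 strict_leibniz0 (tt_d T)
          (rho01 T) (rho10 T)).
- by move=> x y; apply: tt_d01.
- split; [exact: rho01_sesq | exact: rho10_sesq | exact: strict_leib001
         | exact: strict_leib010 | exact: strict_leib100].
- by move=> h x; apply: tt_d01.
- by move=> x h; apply: tt_d10.
- by [].
- by move=> x y; apply: tt_peiffer.
(* In the last term, [tt_d10] puts the bracket of [tt_d T x] and h in the image of [tt_d T]; the
   Peiffer identity then moves [tt_d T] over to y. *)
- move=> x y h /=; rewrite strict_leib010 -tt_d10; congr (_ + _).
  by apply/funext => a; apply/funext => b; rewrite /nest_ml tt_peiffer.
- by move=> x h y /=; rewrite strict_leib001 -tt_d10.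
- by move=> h x y /=; rewrite strict_leib001 -tt_d01.
Defined.

End StrictToCrossed.

Definition two_term_of_crossed (K : fieldType) (g h : lmodType {poly K})
  (X : crossed_on g h) : two_term g h.
Proof.
apply: (@TwoTerm K g h (cm_d X) (cm_h X) (cm_l X) (cm_r X) (fun _ _ _ => 0)).
- exact: lbr_sesq.
- exact: rep_sesql (cm_rep X).
- exact: rep_sesqr (cm_rep X).
- exact: sesquilinear3_0.
- exact: cm_dl.
- exact: cm_dr.
- by move=> u v; rewrite cm_peifferl cm_peifferr.
- move=> x y z; rewrite -(iffRL (sub2_eq0 _ _ _) (lbr_leibniz _ x y z)).
  by apply/funext => a; apply/funext => b; rewrite linear0.
- by move=> x y v; apply/sub2_eq0/(rep_ll (cm_rep X)).
- by move=> x v y; apply/sub2_eq0/(rep_lr (cm_rep X)).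
- by move=> v x y; apply/sub2_eq0/(rep_rr (cm_rep X)).
(* Every term of the coherence law contains [rho3]; where it sits under an action, linearity of the
   action is needed. The argument there is a coefficient of the zero series, 0 only up to
   conversion, hence the explicit rewrite patterns. *)
- have l0 x : cm_l X x 0 = 0 := sesquilinear2_0r (rep_sesql (cm_rep X)) x.
  have r0 x : cm_r X 0 x = 0 := sesquilinear2_0l (rep_sesqr (cm_rep X)) x.
  move=> x y z w a b c.
  rewrite big1 => [|i _]; last first.
    rewrite big1 // => j _.
    by rewrite [cm_r X _ w](r0 w) subst_add3_0.
  rewrite !big1; try by move=> i _; apply: mul0rn.
  by rewrite [cm_l X x _]l0 [cm_l X y _]l0 [cm_l X z _]l0 !(subr0, addr0).
Defined.

Lemma leibniz_on_eq (K : fieldType) (g : lmodType {poly K})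
  (b c : leibniz_on g) : lbr b = lbr c -> b = c.
Proof.
case: b c => b bS bL [c cS cL] /= bc; case: _ / bc in cS cL *.
by rewrite (Prop_irrelevance cS bS) (Prop_irrelevance cL bL).
Qed.

Lemma crossed_on_eq (K : fieldType) (g h : lmodType {poly K})
    (X Y : crossed_on g h) :
  cm_g X = cm_g Y -> cm_h X = cm_h Y -> cm_d X = cm_d Y ->
  cm_l X = cm_l Y -> cm_r X = cm_r Y -> X = Y.
Proof.
by case: X Y => ? ? ? ? ? ? ? ? ? ? ? ? ? ? [] /= *; subst;
  congr CrossedOn; apply: Prop_irrelevance.
Qed.

Lemma two_term_eq (K : fieldType) (G1 G0 : lmodType {poly K})
    (S T : two_term G1 G0) :
  tt_d S = tt_d T -> rho00 S = rho00 T -> rho01 S = rho01 T ->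
  rho10 S = rho10 T -> rho3 S = rho3 T -> S = T.
Proof.
by case: S T => ? ? ? ? ? ? ? ? ? ? ? ? ? ? ? ? ? [] /= *; subst;
  congr TwoTerm; apply: Prop_irrelevance.
Qed.

Lemma strict_leib_infty_eq (K : fieldType) (G1 G0 : lmodType {poly K})
    (S T : two_term G1 G0) hS hT :
  S = T -> @StrictLeibInfty K G1 G0 S hS = @StrictLeibInfty K G1 G0 T hT.
Proof.
by move=> ST; subst T; congr StrictLeibInfty; apply: Prop_irrelevance.
Qed.

Definition strict_of_crossed (K : fieldType) (X : crossed_module K) :
    strict_leib_infty K :=
  @StrictLeibInfty K _ _ (two_term_of_crossed X) (fun _ _ _ => erefl).

Definition crossed_module_of_strict (K : fieldType) (A : strict_leib_infty K) :
    crossed_module K :=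
  CrossedModule (crossed_of_strict (@sl_strict K A)).

Lemma crossed_module_of_strictK (K : fieldType) :
  cancel (@crossed_module_of_strict K) (@strict_of_crossed K).
Proof.
case=> G1 G0 T T0; apply: strict_leib_infty_eq.
apply: two_term_eq => //=.
(* Only [rho3] is not restored by computation: it came back as the constant 0, which strictness
   identifies with the original. *)
by apply/funext => x; apply/funext => y; apply/funext => z; rewrite T0.
Qed.

Lemma strict_of_crossedK (K : fieldType) :
  cancel (@strict_of_crossed K) (@crossed_module_of_strict K).
Proof.
case=> g h X; congr CrossedModule; apply: crossed_on_eq => //=.
- apply: leibniz_on_eq => /=.
  (* The bracket on g came back as [cm_l X (cm_d X x) y]. *)
  by apply/funext => x; apply/funext => y; rewrite cm_peifferl.
(* The bracket on h is the same map with a rebuilt proof of the Leibniz identity. *)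
- exact: leibniz_on_eq.
Qed.

(* The correspondence is the canonical one: it keeps the underlying
   C[d]-modules, with g = G_1 and h = G_0. *)
Theorem theorem4p8 (R : realType) :
  exists F : strict_leib_infty R[i] -> crossed_module R[i],
    bijective F /\
    forall A : strict_leib_infty R[i],
      exists X : crossed_on (sl_G1 A) (sl_G0 A),
        F A = CrossedModule X /\
        cm_d X = tt_d A /\
        lbr (cm_h X) = rho00 A /\
        cm_l X = rho01 A /\
        cm_r X = rho10 A /\
        lbr (cm_g X) = (fun u v => rho01 A (tt_d A u) v).
Proof.
exists (@crossed_module_of_strict _); split.
  by exists (@strict_of_crossed _);
    [exact: crossed_module_of_strictK | exact: strict_of_crossedK].
by move=> A; exists (crossed_of_strict (@sl_strict _ A)).
Qed.
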